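(* Let $(P\colon\mathcal{E}\to\mathcal{B},J,\mathit{Triv})$ be a fibred site with trivial objects. Then the subfunctor of locally trivial objects $\mathit{Loc}\subset P$ is a subfibration of $P$. Moreover, it is replete and globally full.
   Context: Subfunctors. For a functor $P\colon\mathcal{E}\to\mathcal{B}$, a subfunctor $Q\subset P$ consists of subcategories $Q_t\subset\mathcal{E}$ and $Q_b\subset\mathcal{B}$ such that $P$ restricts to a functor $Q\colon Q_t\to Q_b$. Fibres are $\mathcal{E}_B=P^{-1}(B)$. $Q$ is globally full if $Q_t\subset\mathcal{E}$ and $Q_b\subset\mathcal{B}$ are full subcategories; it is replete if each fibre $Q_B$ ($B\in Q_b$) is a replete subcategory of $\mathcal{E}_B$ (any isomorphism of $\mathcal{E}_B$ with domain in $Q_B$ lies, together with its codomain, in $Q_B$). Let $P$ be a (Grothendieck) fibration. A subfibration of $P$ is a subfunctor $Q\subset P$ that is a fibration and whose inclusion functor $Q_t\to\mathcal{E}$ preserves Cartesian arrows. A subfunctor of trivial objects is a subfunctor $\mathit{Triv}\colon\mathit{Triv}_t\to\mathit{Triv}_b$ of $P$ that is globally full and replete; objects of $\mathit{Triv}_t$ and of $\mathit{Triv}_b$ are called trivial. A subfibration of trivial objects is a subfunctor of trivial objects that is a subfibration. Coverings. A covering of an object $C$ of a category is a set of arrows with codomain $C$. A covering $S$ refines a covering $R$ (of the same object) if each arrow of $S$ factors through some arrow of $R$. A covering function $J$ on a category assigns to each object $C$ a class $J(C)$ of coverings of $C$ (the $J$-coverings). Axioms: (M) $\{1_C\}\in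 J(C)$ for every $C$; (C) given a $J$-covering $R$ of $C$ and an arrow $f\colon B\to C$, there is a $J$-covering $S$ of $B$ such that $\{f\circ g\mid g\in S\}$ refines $R$. A fibred site $(P,J)$ is a fibration $P\colon\mathcal{E}\to\mathcal{B}$ with a covering function $J$ on $\mathcal{B}$. Local triviality. An object $B\in\mathcal{B}$ is locally trivial for a covering $R$ of $B$ if the domains of all arrows of $R$ are trivial. An object $E\in\mathcal{E}$ is locally trivial for a covering $R$ of $P(E)$ if the inverse images $f^*E$ of $E$ along all arrows $f\in R$ are trivial (in $\mathit{Triv}_t$). An object of $\mathcal{B}$ or $\mathcal{E}$ is locally trivial if it is so for some $J$-covering. $\mathit{Loc}\colon\mathit{Loc}_t\to\mathit{Loc}_b$ is the restriction of $P$ to the full subcategories of $\mathcal{E}$ and $\mathcal{B}$ of locally trivial objects. $J_l$ is the covering function on $\mathit{Loc}_b$ whose coverings are the $J$-coverings all of whose arrows have trivial domains. A fibred site with trivial objects $(P,J,\mathit{Triv})$ is a fibred site $(P,J)$ with a subfibration of trivial objects $\mathit{Triv}\subset P$ such that $J$ satisfies (M) and $J_l$ (on $\mathit{Loc}_b$) satisfies (C). *)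

(* Defs.v *)
From Stdlib Require Import ProofIrrelevance.

Set Implicit Arguments.
Unset Strict Implicit.
Unset Printing Implicit Defensive.

(** * Categories and functors *)

Reserved Notation "g \o f" (at level 40, left associativity).

Record category := Category {
  Ob :> Type;
  Hom : Ob -> Ob -> Type;
  idm : forall X, Hom X X;
  comp : forall X Y Z, Hom Y Z -> Hom X Y -> Hom X Z;
  comp_idl : forall X Y (f : Hom X Y), comp (idm Y) f = f;
  comp_idr : forall X Y (f : Hom X Y), comp f (idm X) = f;
  comp_assoc : forall W X Y Z (h : Hom Y Z) (g : Hom X Y) (f : Hom W X),
    comp h (comp g f) = comp (comp h g) f
}.

Arguments Hom {_} _ _.
Arguments idm {_} _.
Arguments comp {_ _ _ _} _ _.
Notation "g \o f" := (comp g f).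

Record functor (C D : category) := Functor {
  fob :> C -> D;
  fmap : forall X Y, Hom X Y -> Hom (fob X) (fob Y);
  fmap_id : forall X, fmap (idm X) = idm (fob X);
  fmap_comp : forall X Y Z (g : Hom Y Z) (f : Hom X Y),
    fmap (g \o f) = fmap g \o fmap f
}.

Arguments fmap {_ _} _ {_ _} _.

(** Equality of arrows whose domains and codomains are not known in advance
    to coincide: [arr_eq f g] forces [X = X'], [Y = Y'], and [f = g] along
    these equalities.  It renders equations such as [P f = 1_B]. *)
Inductive arr_eq (C : category) (X Y : C) (f : Hom X Y) :
    forall X' Y' : C, Hom X' Y' -> Prop :=
  arr_eq_refl : arr_eq f f.

Definition is_iso (C : category) (X Y : C) (f : Hom X Y) : Prop :=
  exists g : Hom Y X, g \o f = idm X /\ f \o g = idm Y.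

(** * Subcategories *)

Record subcat (C : category) := Subcat {
  sub_ob : C -> Prop;
  sub_hom : forall X Y : C, Hom X Y -> Prop;
  sub_dom : forall (X Y : C) (f : Hom X Y), sub_hom f -> sub_ob X;
  sub_cod : forall (X Y : C) (f : Hom X Y), sub_hom f -> sub_ob Y;
  sub_id : forall X : C, sub_ob X -> sub_hom (idm X);
  sub_comp : forall (X Y Z : C) (g : Hom Y Z) (f : Hom X Y),
    sub_hom g -> sub_hom f -> sub_hom (g \o f)
}.

Arguments sub_hom {_} _ {_ _} _.

Lemma sig_eq (A : Type) (P : A -> Prop) (x y : {a | P a}) :
  proj1_sig x = proj1_sig y -> x = y.
Proof.
destruct x as [x p], y as [y q]; simpl; intros e; subst y.
now rewrite (proof_irrelevance _ p q).
Qed.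

Definition subcat_cat (C : category) (S : subcat C) : category.
Proof.
refine (@Category {X : C | sub_ob S X}
  (fun X Y => {f : Hom (proj1_sig X) (proj1_sig Y) | sub_hom S f})
  (fun X => exist _ (idm (proj1_sig X)) (sub_id (proj2_sig X)))
  (fun X Y Z g f => exist _ (proj1_sig g \o proj1_sig f)
                      (sub_comp (proj2_sig g) (proj2_sig f)))
  _ _ _).
- intros; apply sig_eq; apply comp_idl.
- intros; apply sig_eq; apply comp_idr.
- intros; apply sig_eq; apply comp_assoc.
Defined.

Definition full (C : category) (S : subcat C) : Prop :=
  forall (X Y : C) (f : Hom X Y), sub_ob S X -> sub_ob S Y -> sub_hom S f.

Definition replete (C : category) (S : subcat C) : Prop :=
  forall (X Y : C) (f : Hom X Y),
    is_iso f -> sub_ob S X -> sub_ob S Y /\ sub_hom S f.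

Definition full_subcat (C : category) (D : C -> Prop) : subcat C.
Proof.
refine (@Subcat C D (fun X Y _ => D X /\ D Y) _ _ _ _); tauto.
Defined.

(** * Fibres, Cartesian arrows, fibrations *)

Lemma arr_eq_comp (C : category) (X Y Z X' Y' Z' : C)
    (g : Hom Y Z) (f : Hom X Y) (g' : Hom Y' Z') (f' : Hom X' Y') :
  arr_eq g g' -> arr_eq f f' -> arr_eq (g \o f) (g' \o f').
Proof.
intros Hg Hf.
destruct Hg.
enough (H : forall Y2 (f2 : Hom X' Y2) (e : Y2 = Y), arr_eq f f2 ->
    arr_eq (g \o f) (g \o eq_rect Y2 (Hom X') f2 Y e))
  by exact (H _ f' eq_refl Hf).
intros Y2 f2 e Hf2; destruct Hf2.
rewrite (proof_irrelevance _ e eq_refl); constructor.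
Qed.

Definition fibre (E B : category) (P : functor E B) (b : B) : category.
Proof.
refine (@Category {X : E | P X = b}
  (fun X Y => {f : Hom (proj1_sig X) (proj1_sig Y) |
                 arr_eq (fmap P f) (idm b)})
  (fun X => exist _ (idm (proj1_sig X)) _)
  (fun X Y Z g f => exist _ (proj1_sig g \o proj1_sig f) _)
  _ _ _).
Unshelve.
4: { rewrite fmap_id; destruct X as [X e]; simpl; subst b; constructor. }
4: { rewrite fmap_comp, <- (comp_idl (idm b)).
     exact (arr_eq_comp (proj2_sig g) (proj2_sig f)). }
- intros; apply sig_eq; apply comp_idl.
- intros; apply sig_eq; apply comp_idr.
- intros; apply sig_eq; apply comp_assoc.
Defined.

Definition cartesian (E B : category) (P : functor E B) (X Y : E)
    (f : Hom X Y) : Prop :=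
  forall (Z : E) (g : Hom Z Y) (u : Hom (P Z) (P X)),
    fmap P f \o u = fmap P g ->
    exists! h : Hom Z X, fmap P h = u /\ f \o h = g.

Definition cartesian_lift (E B : category) (P : functor E B)
    (b : B) (Y : E) (f : Hom b (P Y)) (X : E) (phi : Hom X Y) : Prop :=
  cartesian P phi /\ arr_eq (fmap P phi) f.

Definition is_inverse_image (E B : category) (P : functor E B)
    (b : B) (Y : E) (f : Hom b (P Y)) (X : E) : Prop :=
  exists phi : Hom X Y, cartesian_lift f phi.

Definition is_fibration (E B : category) (P : functor E B) : Prop :=
  forall (Y : E) (b : B) (f : Hom b (P Y)),
    exists (X : E) (phi : Hom X Y), cartesian_lift f phi.

(** * Subfunctors *)

Record subfunctor (E B : category) (P : functor E B) := Subfunctor {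
  top : subcat E;
  bot : subcat B;
  restr_ob : forall X : E, sub_ob top X -> sub_ob bot (P X);
  restr_hom : forall (X Y : E) (f : Hom X Y),
    sub_hom top f -> sub_hom bot (fmap P f)
}.

Section Subfunctors.
Variables (E B : category) (P : functor E B) (Q : subfunctor P).

Definition restr : functor (subcat_cat (top Q)) (subcat_cat (bot Q)).
Proof.
refine (@Functor (subcat_cat (top Q)) (subcat_cat (bot Q))
  (fun X => exist _ (P (proj1_sig X)) (restr_ob (proj2_sig X)))
  (fun X Y f => exist _ (fmap P (proj1_sig f)) (restr_hom (proj2_sig f)))
  _ _).
- intros; apply sig_eq; apply fmap_id.
- intros; apply sig_eq; apply fmap_comp.
Defined.

Definition globally_full : Prop := full (top Q) /\ full (bot Q).

Definition sub_fibre (b : B) : subcat (fibre P b).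
Proof.
refine (@Subcat (fibre P b)
  (fun X => sub_ob (top Q) (proj1_sig X))
  (fun X Y f => sub_hom (top Q) (proj1_sig f)) _ _ _ _).
- intros X Y f; exact (@sub_dom _ _ _ _ (proj1_sig f)).
- intros X Y f; exact (@sub_cod _ _ _ _ (proj1_sig f)).
- intros X; exact (@sub_id _ _ (proj1_sig X)).
- intros X Y Z g f; exact (@sub_comp _ _ _ _ _ (proj1_sig g) (proj1_sig f)).
Defined.

Definition subfunctor_replete : Prop :=
  forall b : B, sub_ob (bot Q) b -> replete (sub_fibre b).

Definition is_subfibration : Prop :=
  is_fibration restr /\
  forall (X Y : subcat_cat (top Q)) (f : Hom X Y),
    cartesian restr f -> cartesian P (proj1_sig f).

Definition is_subfunctor_of_trivial_objects : Prop :=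
  globally_full /\ subfunctor_replete.

Definition is_subfibration_of_trivial_objects : Prop :=
  is_subfunctor_of_trivial_objects /\ is_subfibration.

End Subfunctors.

(** * Coverings *)

Definition covering (C : category) (c : C) : Type :=
  forall b : C, Hom b c -> Prop.

Definition covering_function (C : category) : Type :=
  forall c : C, covering c -> Prop.

Section Coverings.
Variable C : category.

Definition id_covering (c : C) : covering c :=
  fun _ f => arr_eq f (idm c).

Definition push_covering (b c : C) (f : Hom b c) (S : covering b) :
    covering c :=
  fun _ h => exists g, S _ g /\ h = f \o g.

Definition refines (c : C) (S R : covering c) : Prop :=
  forall (a : C) (s : Hom a c), S a s ->
    exists (b : C) (r : Hom b c), R b r /\ exists k : Hom a b, s = r \o k.

Definition axiom_M (J : covering_function C) : Prop :=
  forall c : C, J c (@id_covering c).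

Definition axiom_C (J : covering_function C) : Prop :=
  forall (c : C) (R : covering c), J c R ->
  forall (b : C) (f : Hom b c),
    exists S : covering b, J b S /\ refines (push_covering f S) R.

End Coverings.

Record fibred_site (E B : category) := FibredSite {
  site_fun :> functor E B;
  site_fib : is_fibration site_fun;
  site_cov : covering_function B
}.

(** * Locally trivial objects *)

Section LocallyTrivial.
Variables (E B : category) (P : fibred_site E B) (Triv : subfunctor P).

Definition base_loc_triv_for (b : B) (R : covering b) : Prop :=
  forall (a : B) (f : Hom a b), R a f -> sub_ob (bot Triv) a.

(** No cleavage is fixed: [f^*Y] ranges over all domains of Cartesian lifts of
    [f] at [Y].  These exist because [P] is a fibration and differ by vertical
    isomorphisms, so for replete [Triv] it does not matter which one is
    tested. *)
Definition tot_loc_triv_for (Y : E) (R : covering (P Y)) : Prop :=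
  forall (a : B) (f : Hom a (P Y)), R a f ->
  forall X : E, is_inverse_image f X -> sub_ob (top Triv) X.

Definition base_loc_triv (b : B) : Prop :=
  exists R : covering b, site_cov P R /\ base_loc_triv_for R.

Definition tot_loc_triv (Y : E) : Prop :=
  exists R : covering (P Y), site_cov P R /\ tot_loc_triv_for R.

Lemma base_loc_triv_of_tot (Y : E) : tot_loc_triv Y -> base_loc_triv (P Y).
Proof.
intros [R [HJ HR]]; exists R; split; [exact HJ|].
intros a f Rf.
destruct (site_fib f) as [X [phi Hphi]].
assert (HX := HR a f Rf X (ex_intro _ phi Hphi)).
apply restr_ob in HX.
destruct Hphi as [_ e]; clear HR Rf; destruct e; exact HX.
Qed.

Definition Loc : subfunctor P.
Proof.
refine (@Subfunctor E B P
  (full_subcat tot_loc_triv) (full_subcat base_loc_triv) _ _).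
- exact base_loc_triv_of_tot.
- intros X Y f [HX HY]; split; now apply base_loc_triv_of_tot.
Defined.

(** A covering in [Loc_b], seen as a set of arrows of [B]. *)
Definition incl_covering (b : subcat_cat (bot Loc)) (S : covering b) :
    covering (proj1_sig b) :=
  fun a f => exists (Ha : base_loc_triv a) (Hf : sub_hom (bot Loc) f),
    S (exist _ a Ha) (exist _ f Hf).

(** A trivial object of [B] is locally trivial when [site_cov P] satisfies
    [axiom_M], so asking the arrows to lie in [Loc_b] then loses no covering
    of an object of [Loc_b] by arrows with trivial domains. *)
Definition loc_cov : covering_function (subcat_cat (bot Loc)) :=
  fun b S => site_cov P (incl_covering S) /\
    forall (a : subcat_cat (bot Loc)) (f : Hom a b),
      S a f -> sub_ob (bot Triv) (proj1_sig a).

Definition with_trivial_objects : Prop :=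
  is_subfibration_of_trivial_objects Triv /\
  axiom_M (site_cov P) /\
  axiom_C loc_cov.

End LocallyTrivial.

(* Main.v *)
(** Everything rests on one fact: if [phi : X -> Y] is Cartesian, [Y] is
    locally trivial for [R] and [P X] is locally trivial, then so is [X].
    Axiom (C) for [J_l] gives a covering [S] of [P X] by trivial objects such
    that each [P phi \o s] with [s] in [S] factors as [r \o k] with [r] in [R].
    Then [s^*X] is an inverse image of [Y] along [r \o k], hence isomorphic to
    [k^*(r^*Y)]; here [r^*Y] is trivial, and [k^*(r^*Y)] may be computed in
    the subfibration [Triv]. *)

From Stdlib Require Import ProofIrrelevance FunctionalExtensionality
  PropExtensionality.
Require Import Defs.

Set Implicit Arguments.
Unset Strict Implicit.
Unset Printing Implicit Defensive.

(** * Heterogeneous equality of arrows *)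

(** Elimination needs free endpoints, so the claim is generalised to transports along arbitrary
    equalities of objects; proof irrelevance then makes these transports trivial. *)
Lemma arr_eq_eq (C : category) (X Y : C) (f g : Hom X Y) :
  arr_eq f g -> f = g.
Proof.
intros H.
enough (K : forall X' Y' (f' : Hom X' Y'), arr_eq f f' ->
    forall (e : X' = X) (e' : Y' = Y),
      f = eq_rect Y' (Hom X) (eq_rect X' (fun x => Hom x Y') f' X e) Y e')
  by exact (K _ _ g H eq_refl eq_refl).
intros X' Y' f' []; intros e e'.
now rewrite (proof_irrelevance _ e eq_refl),
  (proof_irrelevance _ e' eq_refl).
Qed.

(** Plain [destruct] does not apply when the common codomain is not a
    variable, for instance when it is [P Y]. *)
Lemma arr_eq_dom_ind (C : category) (X Y : C) (f : Hom X Y)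
    (K : forall X' : C, Hom X' Y -> Prop) :
  K X f -> forall (X' : C) (f' : Hom X' Y), arr_eq f f' -> K X' f'.
Proof.
intros Kf X' f' H.
assert (e : X = X') by now destruct H.
subst X'; now rewrite <- (arr_eq_eq H).
Qed.

Lemma arr_eq_sym (C : category) (X Y X' Y' : C) (f : Hom X Y)
    (f' : Hom X' Y') :
  arr_eq f f' -> arr_eq f' f.
Proof. intros []; constructor. Qed.

Lemma arr_eq_trans (C : category) (X Y X' Y' X'' Y'' : C) (f : Hom X Y)
    (f' : Hom X' Y') (f'' : Hom X'' Y'') :
  arr_eq f f' -> arr_eq f' f'' -> arr_eq f f''.
Proof. now intros []. Qed.

(** The arrows [i] and [j] are identities in disguise; they replace transport along [X = X'] by
    composition. *)
Lemma arr_eq_dom_iso (C : category) (X X' Y : C) (f : Hom X Y)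
    (f' : Hom X' Y) :
  arr_eq f f' ->
  exists (i : Hom X X') (j : Hom X' X),
    j \o i = idm X /\ i \o j = idm X' /\ f = f' \o i /\ f' = f \o j /\
    arr_eq i (idm X) /\ arr_eq j (idm X).
Proof.
revert X' f'; apply arr_eq_dom_ind.
exists (idm X), (idm X).
rewrite !comp_idl, !comp_idr; repeat split.
Qed.

Lemma arr_eq_sub (C : category) (S : subcat C) (X Y X' Y' : subcat_cat S)
    (f : Hom X Y) (f' : Hom X' Y') :
  arr_eq f f' -> arr_eq (proj1_sig f) (proj1_sig f').
Proof. intros []; constructor. Qed.

Lemma sub_arr_eq (C : category) (S : subcat C) (X X' Y : subcat_cat S)
    (f : Hom X Y) (f' : Hom X' Y) :
  arr_eq (proj1_sig f) (proj1_sig f') -> arr_eq f f'.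
Proof.
destruct X as [x hx], X' as [x' hx'], f as [f p], f' as [f' p']; simpl in *.
intros H; revert x' f' H hx' p'.
apply (@arr_eq_dom_ind _ _ _ f (fun x' f' => forall hx' p', _)).
intros hx' p'.
now rewrite (proof_irrelevance _ hx' hx),
  (proof_irrelevance _ p' p).
Qed.

(** * Cartesian arrows *)

Section Cartesian.
Variables (E B : category) (P : functor E B).

Lemma cartesian_comp (X Y Z : E) (g : Hom Y Z) (f : Hom X Y) :
  cartesian P g -> cartesian P f -> cartesian P (g \o f).
Proof.
intros Hg Hf W h u e.
rewrite fmap_comp, <- comp_assoc in e.
destruct (Hg W h _ e) as [v [[v1 v2] vu]].
destruct (Hf W v u (eq_sym v1)) as [w [[w1 w2] wu]].
exists w; split.
- now rewrite <- comp_assoc, w2.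
- intros w' [e1 e2]; apply wu; split; [exact e1|].
  symmetry; apply vu.
  now rewrite fmap_comp, e1, comp_assoc.
Qed.

Lemma iso_cartesian (X Y : E) (f : Hom X Y) : is_iso f -> cartesian P f.
Proof.
intros [g [gf fg]] Z h u e.
exists (g \o h); split; [split|].
- now rewrite fmap_comp, <- e, comp_assoc, <- fmap_comp, gf, fmap_id, comp_idl.
- now rewrite comp_assoc, fg, comp_idl.
- intros k [_ <-]; now rewrite comp_assoc, gf, comp_idl.
Qed.

Lemma cartesian_inj (X Y : E) (f : Hom X Y) (Z : E) (h h' : Hom Z X) :
  cartesian P f -> fmap P h = fmap P h' -> f \o h = f \o h' -> h = h'.
Proof.
intros Hf e1 e2.
destruct (Hf Z (f \o h') (fmap P h')) as [k [_ ku]].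
- now rewrite fmap_comp.
- now rewrite <- (ku h), <- (ku h').
Qed.

(** Each arrow factors through the other over a disguised identity of the base; uniqueness of
    factorisations makes the two comparison arrows mutually inverse. *)
Lemma cartesian_same_iso (X X' Y : E) (f : Hom X Y) (f' : Hom X' Y) :
  cartesian P f -> cartesian P f' -> arr_eq (fmap P f) (fmap P f') ->
  exists (h : Hom X X') (k : Hom X' X),
    k \o h = idm X /\ h \o k = idm X' /\ f = f' \o h /\
    arr_eq (fmap P h) (idm (P X)) /\ arr_eq (fmap P k) (idm (P X)).
Proof.
intros Hf Hf' e.
destruct (arr_eq_dom_iso e) as (i & j & ji & ij & ei & ej & ai & aj).
destruct (Hf' X f i (eq_sym ei)) as [h [[h1 h2] _]].
destruct (Hf X' f' j (eq_sym ej)) as [k [[k1 k2] _]].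
exists h, k; repeat split.
- apply (cartesian_inj Hf).
  + now rewrite fmap_comp, k1, h1, fmap_id.
  + now rewrite comp_assoc, k2, h2, comp_idr.
- apply (cartesian_inj Hf').
  + now rewrite fmap_comp, k1, h1, fmap_id.
  + now rewrite comp_assoc, h2, k2, comp_idr.
- now symmetry.
- now rewrite h1.
- now rewrite k1.
Qed.

End Cartesian.

(** * Full and replete subfunctors *)

Section Subfunctors.
Variables (E B : category) (P : functor E B).

(** The comparison isomorphism is vertical, so repleteness applies in the fibre over [P X]. Hence
    any inverse image may be tested in place of another. *)
Lemma replete_cartesian (Q : subfunctor P) (X X' Y : E) (f : Hom X Y)
    (f' : Hom X' Y) :
  subfunctor_replete Q ->
  cartesian P f -> cartesian P f' -> arr_eq (fmap P f) (fmap P f') ->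
  sub_ob (top Q) X -> sub_ob (top Q) X'.
Proof.
intros Hrep Hf Hf' e HX.
destruct (cartesian_same_iso Hf Hf' e) as (h & k & kh & hk & _ & ah & ak).
assert (eP : P X' = P X) by now destruct e.
pose (x := exist (fun Z : E => P Z = P X) X eq_refl : fibre P (P X)).
pose (x' := exist (fun Z : E => P Z = P X) X' eP : fibre P (P X)).
pose (vh := exist _ h ah : Hom x x').
pose (vk := exist _ k ak : Hom x' x).
refine (proj1 (Hrep (P X) (restr_ob HX) x x' vh _ HX)).
exists vk; split; now apply sig_eq.
Qed.

Lemma full_cartesian_restr (Q : subfunctor P) (X Y : subcat_cat (top Q))
    (f : Hom X Y) :
  full (top Q) -> cartesian P (proj1_sig f) -> cartesian (restr Q) f.
Proof.
intros Hfull Hf Z g u e.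
apply (f_equal (@proj1_sig _ _)) in e; simpl in e.
destruct (Hf _ _ _ e) as [h [[h1 h2] hu]].
exists (exist _ h (Hfull _ _ h (proj2_sig Z) (proj2_sig X))).
split; [split; now apply sig_eq|].
intros h' [e1 e2]; apply sig_eq; simpl; apply hu; split.
- now rewrite <- e1.
- now rewrite <- e2.
Qed.

(** Closure puts the lifts taken in [P] inside [Q], where fullness keeps them Cartesian. *)
Lemma full_subfibration (Q : subfunctor P) :
  is_fibration P -> globally_full Q ->
  (forall (X Y : E) (f : Hom X Y), cartesian P f ->
     sub_ob (top Q) Y -> sub_ob (bot Q) (P X) -> sub_ob (top Q) X) ->
  is_subfibration Q.
Proof.
intros Hfib [Hft Hfb] Hcl; split.
- intros Y b f.
  destruct (Hfib _ _ (proj1_sig f)) as (X & phi & Hphi & e).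
  assert (HX : sub_ob (top Q) X).
  { apply (Hcl _ _ _ Hphi (proj2_sig Y)).
    replace (P X) with (proj1_sig b) by now destruct e.
    exact (proj2_sig b). }
  exists (exist _ X HX), (exist _ phi (Hft _ _ phi HX (proj2_sig Y))); split.
  + now apply full_cartesian_restr.
  + now apply sub_arr_eq.
- intros X Y f Hf.
  (* A second lift of the same base arrow, Cartesian for both [P] and [restr Q]; [f] differs from it
     by an isomorphism, hence is Cartesian for [P]. *)
  destruct (Hfib _ _ (fmap P (proj1_sig f))) as (X' & phi & Hphi & e).
  assert (HX' : sub_ob (top Q) X').
  { apply (Hcl _ _ _ Hphi (proj2_sig Y)).
    replace (P X') with (P (proj1_sig X)) by now destruct e.
    exact (restr_ob (proj2_sig X)). }
  pose (x' := exist _ X' HX' : subcat_cat (top Q)).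
  pose (phi' := exist _ phi (Hft _ _ phi HX' (proj2_sig Y)) : Hom x' Y).
  assert (Hphi' : cartesian (restr Q) phi') by now apply full_cartesian_restr.
  assert (e' : arr_eq (fmap (restr Q) f) (fmap (restr Q) phi'))
    by now apply sub_arr_eq, arr_eq_sym.
  destruct (cartesian_same_iso Hf Hphi' e') as (h & k & kh & hk & ef & _).
  rewrite ef; simpl; apply cartesian_comp; [exact Hphi|].
  apply iso_cartesian; exists (proj1_sig k); split.
  + exact (f_equal (@proj1_sig _ _) kh).
  + exact (f_equal (@proj1_sig _ _) hk).
Qed.

End Subfunctors.

(** * Locally trivial objects *)

Section LocallyTrivial.
Variables (E B : category) (P : fibred_site E B) (Triv : subfunctor P).

Lemma base_triv_loc_triv (b : B) :
  axiom_M (site_cov P) -> sub_ob (bot Triv) b -> base_loc_triv Triv b.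
Proof.
intros hM Hb; exists (@id_covering B b); split; [apply hM|].
intros a f Hf; apply arr_eq_sym in Hf.
revert a f Hf; now apply (@arr_eq_dom_ind _ _ _ (idm b)).
Qed.

(** The inverse image of [Y] along [r] is trivial and lies over [a], and [P] maps trivial objects to
    trivial objects. *)
Lemma tot_loc_triv_base (Y : E) (R : covering (P Y)) (a : B)
    (r : Hom a (P Y)) :
  tot_loc_triv_for Triv R -> R a r -> sub_ob (bot Triv) a.
Proof.
intros HR Rr.
destruct (site_fib r) as (V & rho & Hrho & e).
assert (TV : sub_ob (top Triv) V)
  by (apply (HR _ _ Rr); now exists rho).
clear Rr; revert a r e; apply (@arr_eq_dom_ind _ _ _ (fmap P rho)).
now apply restr_ob.
Qed.

Lemma tot_loc_triv_cartesian (X Y : E) (phi : Hom X Y) :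
  with_trivial_objects Triv -> cartesian P phi ->
  tot_loc_triv Triv Y -> base_loc_triv Triv (P X) -> tot_loc_triv Triv X.
Proof.
intros ([[[Hft Hfb] Hrep] [Hfib Hpres]] & hM & hC) Hphi HY HX.
assert (HPY : base_loc_triv Triv (P Y)) by now apply base_loc_triv_of_tot.
destruct HY as [R [HJ HR]].
pose (c := exist _ (P Y) HPY : subcat_cat (bot (Loc Triv))).
pose (b := exist _ (P X) HX : subcat_cat (bot (Loc Triv))).
(* [R] read inside [Loc_b]. No arrow is lost: the domains are trivial, hence locally trivial by
   (M). *)
pose (R' := (fun a f => R (proj1_sig a) (proj1_sig f)) : covering c).
pose (f := exist _ (fmap P phi) (conj HX HPY) : Hom b c).
assert (HR' : loc_cov R').
{ split.
  - replace (incl_covering R') with R; [exact HJ|].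
    apply functional_extensionality_dep; intros a.
    apply functional_extensionality_dep; intros r.
    apply propositional_extensionality; split.
    + intros Rr.
      assert (Ha : base_loc_triv Triv a)
        by exact (base_triv_loc_triv hM (tot_loc_triv_base HR Rr)).
      now exists Ha, (conj Ha HPY).
    + now intros (Ha & Hr & Rr).
  - intros a r Rr; exact (tot_loc_triv_base HR Rr). }
destruct (hC c R' HR' b f) as (S & [HJS HS] & Href).
exists (incl_covering S); split; [exact HJS|].
intros a s (Ha & Hs & Ss) W (psi & Hpsi & es).
assert (Ta := HS _ _ Ss); simpl in Ta.
destruct (Href _ _ (ex_intro _ _ (conj Ss eq_refl)))
  as ([d Hd] & [r Hr] & Rr & [k Hk] & e).
apply (f_equal (@proj1_sig _ _)) in e; unfold R' in Rr; simpl in *.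
clear Href Ss Ha Hs Hd Hr Hk.
destruct (site_fib r) as (V & rho & Hrho & er).
assert (TV : sub_ob (top Triv) V)
  by (apply (HR _ _ Rr); now exists rho).
(* Replaces [d] by [P V] and [r] by [fmap P rho], so that [k] ends at the image of a trivial
   object. *)
clear Rr; revert d r er k e.
apply (@arr_eq_dom_ind _ _ _ (fmap P rho) (fun d r => forall k, _ -> _)).
intros k e.
pose (v := exist _ V TV : subcat_cat (top Triv)).
pose (a' := exist _ a Ta : subcat_cat (bot Triv)).
(* By fullness [k] is an arrow of [Triv_b], so its lift [kappa] can be taken with trivial domain
   [u]. *)
pose (k' := exist _ k (Hfb _ _ k Ta (restr_ob TV)) : Hom a' (restr Triv v)).
destruct (Hfib v a' k') as (u & kappa & Hkappa & ek).
apply arr_eq_sub in ek; simpl in ek.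
(* Both composites are Cartesian arrows to [Y] over the same arrow of [B], so triviality passes from
   [u] to [W]. *)
refine (@replete_cartesian _ _ _ _ _ _ _ (rho \o proj1_sig kappa) (phi \o psi)
  Hrep (cartesian_comp Hrho (Hpres _ _ _ Hkappa)) (cartesian_comp Hphi Hpsi) _
  (proj2_sig u)).
rewrite !fmap_comp.
apply arr_eq_trans with (f' := fmap P rho \o k).
- now apply arr_eq_comp.
- rewrite <- e; apply arr_eq_comp; [constructor|now apply arr_eq_sym].
Qed.

Lemma Loc_globally_full : globally_full (Loc Triv).
Proof. now split. Qed.

Lemma Loc_replete :
  with_trivial_objects Triv -> subfunctor_replete (Loc Triv).
Proof.
intros hT b _ [X eX] [Y eY] [f Hf] [[g Hg] [gf fg]] HX; simpl in *.
apply (f_equal (@proj1_sig _ _)) in gf, fg; simpl in gf, fg.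
enough (HY : tot_loc_triv Triv Y) by easy.
(* The inverse [g] is used since local triviality passes from codomain to domain. *)
refine (@tot_loc_triv_cartesian Y X g hT _ HX _).
- apply iso_cartesian; now exists f.
- rewrite eY, <- eX; now apply base_loc_triv_of_tot.
Qed.

End LocallyTrivial.

Theorem proposition3p16 (E B : category) (P : fibred_site E B)
    (Triv : subfunctor P) (hTriv : with_trivial_objects Triv) :
  is_subfibration (Loc Triv) /\
  subfunctor_replete (Loc Triv) /\
  globally_full (Loc Triv).
Proof.
split; [|split].
- apply full_subfibration.
  + exact (@site_fib E B P).
  + apply Loc_globally_full.
  + intros X Y f; now apply tot_loc_triv_cartesian.
- now apply Loc_replete.
- apply Loc_globally_full.
Qed.
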